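(* In the mixed model with i.i.d. initial opinions in a bounded convex set $\Delta\subset\mathbf{R}^d$ and with social graph $G(t)$ connected for infinitely many $t$, assume that $\inf_{t\ge 0}\mu(t)>0$ and $\epsilon>\mathbf{r}$. Then there is $\delta$ such that $$A=\{\|x_i(T_\delta)-\mathbf{c}\|\le\epsilon-\mathbf{r}-\eta\ \text{for some}\ i\in V\}\subset\mathscr{C}\quad\text{for all}\ 0<\eta<\epsilon-\mathbf{r}.$$
   Context: Mixed model. $V$ is a finite set of agents, $\|\cdot\|$ is a norm on $\mathbf{R}^d$, $\epsilon>0$ is the confidence threshold, and time is $t=0,1,2,\ldots$. At time $t$ agent $i$ has opinion $x_i(t)\in\mathbf{R}^d$; the social graph at time $t$ is $G(t)=(V,E(t))$, where $E(t)$ is the set of pairs $(i,j)$ of agents that are socially connected at time $t$ (it may vary with $t$); and the convergence parameter at time $t$ is $\mu(t)\in[0,1/2]$, which may also vary with $t$. At each time step two socially connected agents are selected uniformly at random. If $i$ and $j$ are the agents selected at time $t$, then $$x_i(t+1)=x_i(t)+\mu(t)(x_j(t)-x_i(t))\mathbf{1}\{\|x_i(t)-x_j(t)\|\le\epsilon\},$$ $$x_j(t+1)=x_j(t)+\mu(t)(x_i(t)-x_j(t))\mathbf{1}\{\|x_i(t)-x_j(t)\|\le\epsilon\},$$ while all other opinions are unchanged. The opinion graph is $\mathscr{G}(t)=(V,\mathscr{E}(t))$ with $\mathscr{E}(t)=\{(i,j):\|x_i(t)-x_j(t)\|\le\epsilon\}$, and the profile at time $t$ is $G(t)\cap\mathscr{G}(t)$,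 the graph on $V$ with edge set $E(t)\cap\mathscr{E}(t)$. The length of an edge $(i,j)$ at time $t$ is $\|x_i(t)-x_j(t)\|$. Standing assumptions: the initial opinions $x_i(0)$, $i\in V$, are independent and identically distributed random variables on the bounded convex opinion space $\Delta\subset\mathbf{R}^d$; the social graph $G(t)$ is connected for infinitely many times $t$. Notation: $\mathbf{c}=\arg\inf_{c\in\mathbf{R}^d}\sup_{z\in\Delta}\|z-c\|$ is the center of $\Delta$ (taken to exist uniquely) and $\mathbf{r}=\sup_{z\in\Delta}\|z-\mathbf{c}\|$. The collection of sample points that lead to a consensus is $\mathscr{C}=\{\limsup_{t\to\infty}\max_{i,j\in V}\|x_i(t)-x_j(t)\|=0\}$. For $\delta>0$, $$T_\delta=\inf\{t\ge 0:\ G(t)\cap\mathscr{G}(t)\ \text{is connected and all edges of}\ G(s)\cap\mathscr{G}(s)\ \text{are of length at most}\ \delta\ \text{for all}\ s\ge t\},$$ the earliest time that a profile is connected, with all edges of profiles of length at most $\delta$ afterward.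
   Formalization: The inclusion of A in the consensus event is stated up to a null set (it fails pointwise, e.g. if the same edge of a 3-vertex path is selected forever), and A is taken to require that T_δ is finite, so that x_i(T_δ) is defined. *)

(* Defs.v *)
From HB Require Import structures.
From mathcomp Require Import all_boot all_order all_algebra finmap.
From mathcomp Require Import all_classical all_reals all_analysis.

Set Implicit Arguments.
Unset Strict Implicit.
Unset Printing Implicit Defensive.

Import Order.TTheory GRing.Theory Num.Theory.
Import numFieldNormedType.Exports.

Local Open Scope classical_set_scope.
Local Open Scope ring_scope.

(* An arbitrary norm on R^d; the library's canonical norm on 'rV[R]_d is the
   sup norm, whose topology (the same for every norm) is used below only for
   the Borel sets. *)
Record is_norm (R : realType) (d : nat) (nrm : 'rV[R]_d -> R) : Prop := IsNorm {
  norm_triangle : forall x y, nrm (x + y) <= nrm x + nrm y;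
  norm_scale : forall (a : R) x, nrm (a *: x) = `|a| * nrm x;
  norm_eq0 : forall x, nrm x = 0 -> x = 0 }.

Section Geometry.
Context (R : realType) (d : nat) (nrm : 'rV[R]_d -> R) (Delta : set 'rV[R]_d).

Definition norm_bounded : Prop := exists M : R, forall z, Delta z -> nrm z <= M.

(* For bounded nonempty Delta the supremum is the true one. *)
Definition radius_from (c : 'rV[R]_d) : R := sup [set nrm (z - c) | z in Delta].

(* c is the only minimizer of radius_from. *)
Definition is_center (c : 'rV[R]_d) : Prop :=
  [set c' | radius_from c' = inf (range radius_from)] = [set c].

End Geometry.

Section Graph.
Context (V : finType).

Definition simple_graph (e : rel V) : Prop := symmetric e /\ irreflexive e.

Definition graph_connected (e : rel V) : Prop := forall i j, connect e i j.

(* Ordered pairs: each undirected edge is listed in both orientations. *)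
Definition edges (e : rel V) : {set V * V} := [set p | e p.1 p.2].

End Graph.

Section Dynamics.
Context (R : realType) (d : nat) (nrm : 'rV[R]_d -> R) (V : finType).
Context (eps : R) (mu : nat -> R) (G : nat -> rel V).

Definition opinion_graph (x : V -> 'rV[R]_d) : rel V :=
  fun i j => nrm (x i - x j) <= eps.

Definition moved (m : R) (x : V -> 'rV[R]_d) (i j : V) : 'rV[R]_d :=
  x i + (m * (opinion_graph x i j)%:R) *: (x j - x i).

(* [None] means that no pair is selected, the social graph having no edge. *)
Definition update (m : R) (p : option (V * V)) (x : V -> 'rV[R]_d) :
    V -> 'rV[R]_d :=
  if p is Some (i, j) then
    fun k => if k == i then moved m x i j
             else if k == j then moved m x j i
             else x k
  else x.

Fixpoint opinion (x0 : V -> 'rV[R]_d) (s : nat -> option (V * V)) (t : nat) :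
    V -> 'rV[R]_d :=
  if t is t'.+1 then update (mu t') (s t') (opinion x0 s t') else x0.

Definition profile (x : nat -> V -> 'rV[R]_d) (t : nat) : rel V :=
  fun i j => G t i j && opinion_graph (x t) i j.

Definition settling_times (delta : R) (x : nat -> V -> 'rV[R]_d) : set nat :=
  [set t | graph_connected (profile x t) /\
           forall s, (t <= s)%N -> forall i j, profile x s i j ->
             nrm (x s i - x s j) <= delta].

(* T_delta, with value +oo when there is no such time. *)
Definition settling_time (delta : R) (x : nat -> V -> 'rV[R]_d) : \bar R :=
  ereal_inf [set (t%:R : R)%:E | t in settling_times delta x].

Definition near_center (c : 'rV[R]_d) (rho delta : R)
    (x : nat -> V -> 'rV[R]_d) : Prop :=
  exists2 t : nat, settling_time delta x = (t%:R)%:E &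
    exists i : V, nrm (x t i - c) <= rho.

Definition consensus (x : nat -> V -> 'rV[R]_d) : Prop :=
  limn_esup (fun t =>
    (\big[Num.max/0]_(i : V) \big[Num.max/0]_(j : V) nrm (x t i - x t j))%:E)
  = 0%E.

End Dynamics.

Section Probability.
Context (R : realType) (disp : measure_display) (Omega : measurableType disp).
Context (P : probability Omega R).

(* Mutual independence of a family of classes of events. *)
Definition mutually_independent (I : choiceType)
    (F : I -> set (set Omega)) : Prop :=
  forall (J : {fset I}) (A : I -> set Omega), (forall i, i \in J -> F i (A i)) ->
    P (\bigcap_(i in [set` J]) A i) = (\prod_(i <- J) P (A i))%E.

Definition borel (d : nat) : set (set 'rV[R]_d) := <<s @open 'rV[R]_d >>.

Definition random_vector (d : nat) (X : Omega -> 'rV[R]_d) : Prop :=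
  forall B, borel B -> measurable (X @^-1` B).

Definition identically_distributed (d : nat) (V : Type)
    (X : V -> Omega -> 'rV[R]_d) : Prop :=
  forall i j B, borel B -> P (X i @^-1` B) = P (X j @^-1` B).

(* The pair selected at time t is uniform over the edges of G t; hence it is
   almost surely [None] when G t has no edge. *)
Definition uniform_selection (V : finType) (G : nat -> rel V)
    (sel : nat -> Omega -> option (V * V)) : Prop :=
  forall t p, measurable (sel t @^-1` [set p]) /\
    P (sel t @^-1` [set p]) =
      (if p is Some q then
         if q \in edges (G t) then (#|edges (G t)|%:R)^-1 else 0
       else (edges (G t) == finset.set0)%:R)%:E.

(* The events determined by one initial opinion, or by one selection. *)
Definition source_events (d : nat) (V : finType) (X0 : V -> Omega -> 'rV[R]_d)
    (sel : nat -> Omega -> option (V * V)) (k : V + nat) : set (set Omega) :=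
  match k with
  | inl i => [set X0 i @^-1` B | B in @borel d]
  | inr t => [set sel t @^-1` B | B in setT]
  end.

End Probability.

(* Main.v *)
Require Import Defs.
From HB Require Import structures.
From mathcomp Require Import all_boot all_order all_algebra finmap.
From mathcomp Require Import all_classical all_reals all_analysis.
From mathcomp Require Import ring lra.

Set Implicit Arguments.
Unset Strict Implicit.
Unset Printing Implicit Defensive.

Import Order.TTheory GRing.Theory Num.Theory.
Import numFieldNormedType.Exports.

Local Open Scope classical_set_scope.
Local Open Scope ring_scope.

(* Take delta = eps / (#|V| + 1).  If T_delta is finite, a path of profile edges
   shows that all opinions are within eps of each other at some time, hence
   forever, so that every later selection is active; the position of the agent
   close to the center plays no role.

   Some edge set E of a connected graph is the social graph infinitely often,
   and by the second Borel-Cantelli argument almost surely each of its edges is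
   selected infinitely often.  The sum of the squares of a coordinate decreases
   by at least mu times the squared gap at each active interaction, so the gaps
   of active interactions tend to 0.  Once they are at most h, a gap wider than
   h separating the agents in that coordinate can never be bridged, although an
   edge of E across it is selected again; so consecutive coordinates are within
   h, and every coordinate has diameter at most #|V| h. *)

(** * Paths and gaps in finite graphs *)

Section FiniteGraphs.
Context (R : realType) (V : finType).

(** A duplicate-free path has fewer than [#|V|] edges. [D] may be asymmetric or take negative
    values, so norms and signed differences of coordinates are both covered. *)
Lemma connect_dist_le (D : V -> V -> R) (e : rel V) (h : R) :
  0 <= h -> (forall i, D i i <= 0) ->
  (forall i j k, D i k <= D i j + D j k) -> (forall i j, e i j -> D i j <= h) ->
  forall i j, connect e i j -> D i j <= #|V|%:R * h.
Proof.
move=> h0 Dii Dtri De i j /connectP[p ep ->]; case: (shortenP ep) => q eq uq _.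
have path_le : D i (last i q) <= (size q)%:R * h.
  elim: q i eq {uq ep} => [|k q IHq] i /=; first by rewrite mul0r.
  case/andP=> eik ekq; rewrite -natr1 mulrDl mul1r addrC.
  exact: le_trans (Dtri i k _) (lerD (De _ _ eik) (IHq _ ekq)).
apply: le_trans path_le _; rewrite ler_wpM2r // ler_nat.
by apply: leq_trans (leqnSn _) (_ : size (i :: q) <= _)%N; rewrite -(card_uniqP uq) max_card.
Qed.

Lemma connect_crossing (e : rel V) (A : pred V) (i j : V) :
  connect e i j -> A i -> ~~ A j -> exists a b, [/\ e a b, A a & ~~ A b].
Proof.
case/connectP=> p ep ->; elim: p i ep => [|k p IHp] i /=; first by move=> _ ->.
case/andP=> eik ekp Ai nA; case Ak : (A k); first exact: IHp ekp Ak nA.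
by exists i, k; rewrite Ak.
Qed.

(** Link agents whose values differ by at most [h]. A component spans at most [#|V| * h], and any
    value above its maximum [c] exceeds [c] by more than [h]. *)
Lemma gap_or_close (y : V -> R) (h : R) : 0 <= h ->
  (forall i j, `|y i - y j| <= #|V|%:R * h) \/
  (exists c, [/\ exists i, y i <= c, exists j, c < y j &
                 forall j, c < y j -> c + h < y j]).
Proof.
move=> h0; case: (pselect (forall i j, y j - y i <= #|V|%:R * h)) => [close|].
  left=> i j; rewrite ler_norml; apply/andP; split; last exact: close.
    by have := close i j; lra.
move=> /existsNP[i /existsNP[j /negP]]; rewrite -ltNge => far; right.
pose e := [rel a b : V | `|y a - y b| <= h].
(* The cut is placed at the largest value in the component of [i]. *)
have [a iea amax] : exists2 a, connect e i a &
    forall b, connect e i b -> y b <= y a.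
  case: (@arg_maxP _ _ V i (connect e i) y (connect0 e i)) => a ? ?.
  by exists a.
exists (y a); split; first by exists a.
- exists j; suff : y a - y i <= #|V|%:R * h by lra.
  apply: (@connect_dist_le (fun b c => y c - y b) e) => // [b|b c k|b c /=].
  + by rewrite subrr.
  + by lra.
  + by rewrite ler_norml => /andP[]; lra.
- move=> b ab; rewrite ltNge; apply/negP => bah.
  suff : y b <= y a by lra.
  apply: amax; apply: connect_trans iea (connect1 _) => /=.
  by rewrite ler_norml; apply/andP; split; lra.
Qed.

End FiniteGraphs.

(** * One averaging step: convexity and sums of squares *)

Section Averaging.
Context (R : realType) (d : nat) (nrm : 'rV[R]_d -> R) (V : finType) (eps : R).
Context (nrm_norm : is_norm nrm).

Lemma normN x : nrm (- x) = nrm x.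
Proof. by rewrite -scaleN1r (norm_scale nrm_norm) normrN1 mul1r. Qed.

Lemma normB x y : nrm (x - y) = nrm (y - x).
Proof. by rewrite -opprB normN. Qed.

Lemma norm0 : nrm 0 = 0.
Proof. by rewrite -(scale0r 0) (norm_scale nrm_norm) normr0 mul0r. Qed.

Lemma norm_ge0 x : 0 <= nrm x.
Proof.
have := norm_triangle nrm_norm x (- x).
by rewrite subrr norm0 normN; lra.
Qed.

Lemma norm_dist_triangle x y z : nrm (x - z) <= nrm (x - y) + nrm (y - z).
Proof. by rewrite -{1}(subrKA y); exact: norm_triangle. Qed.

Lemma norm_sum (I : finType) (f : I -> 'rV[R]_d) :
  nrm (\sum_i f i) <= \sum_i nrm (f i).
Proof.
elim/big_ind2: _ => [|x1 x2 y1 y2 h1 h2|//]; first by rewrite norm0.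
exact: le_trans (norm_triangle nrm_norm _ _) (lerD h1 h2).
Qed.

Lemma norm_le_coordinates : exists2 M, 0 < M &
  forall (x : 'rV[R]_d) h, 0 <= h -> (forall k, `|x 0 k| <= h) -> nrm x <= M * h.
Proof.
have s0 : 0 <= \sum_k nrm (delta_mx 0 k).
  by rewrite sumr_ge0 // => k _; exact: norm_ge0.
(* The summand 1 keeps the constant positive even when [d = 0]. *)
exists (1 + \sum_k nrm (delta_mx 0 k)); first by rewrite ltr_pwDl.
move=> x h h0 xh; rewrite [x in nrm x]row_sum_delta.
apply: le_trans (norm_sum _) _; rewrite mulrDl mul1r mulr_suml.
apply: le_trans (_ : \sum_k nrm (delta_mx 0 k) * h <= _); last by rewrite lerDr.
apply: ler_sum => k _; rewrite (norm_scale nrm_norm) mulrC.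
by rewrite ler_wpM2l // norm_ge0.
Qed.

Lemma opinion_graph_sym (x : V -> 'rV[R]_d) : symmetric (opinion_graph nrm eps x).
Proof. by move=> i j; rewrite /opinion_graph normB. Qed.

Lemma update_cases (m : R) p (x : V -> 'rV[R]_d) k :
  update nrm eps m p x k = x k \/
  exists l, [/\ p = Some (k, l) \/ p = Some (l, k), opinion_graph nrm eps x k l &
                update nrm eps m p x k = x k + m *: (x l - x k)].
Proof.
have mv l : moved nrm eps m x k l = x k \/ opinion_graph nrm eps x k l /\
    moved nrm eps m x k l = x k + m *: (x l - x k).
  rewrite /moved; case: opinion_graph; rewrite ?mulr1; [by right|left].
  by rewrite mulr0 scale0r addr0.
case: p => [[i j]|] /=; last by left.
case: eqP => [<-|_].
  by case: (mv j) => [?|[? ?]]; [left|right; exists j; split => //; left].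
case: eqP => [<-|_]; last by left.
by case: (mv i) => [?|[? ?]]; [left|right; exists i; split => //; right].
Qed.

(** A moved opinion is a convex combination of two old ones, and balls are convex. *)
Lemma update_ball (m : R) p (x : V -> 'rV[R]_d) z D : 0 <= m <= 1 ->
  (forall k, nrm (x k - z) <= D) -> forall k, nrm (update nrm eps m p x k - z) <= D.
Proof.
move=> /andP[m0 m1] xD k; case: (update_cases m p x k) => [->//|[l [_ _ ->]]].
have -> : x k + m *: (x l - x k) - z = (1 - m) *: (x k - z) + m *: (x l - z).
  by apply/rowP => q; rewrite !mxE; ring.
apply: le_trans (norm_triangle nrm_norm _ _) _; rewrite !(norm_scale nrm_norm).
rewrite !ger0_norm ?subr_ge0 //.
have -> : D = (1 - m) * D + m * D by ring.
by rewrite lerD // ler_wpM2l ?subr_ge0.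
Qed.

Lemma update_diameter (m : R) p (x : V -> 'rV[R]_d) D : 0 <= m <= 1 ->
  (forall i j, nrm (x i - x j) <= D) ->
  forall i j, nrm (update nrm eps m p x i - update nrm eps m p x j) <= D.
Proof.
(* [update_ball] is used twice: around the new opinion of [i], then around each old opinion
   [x l]. *)
move=> m01 xD i j; rewrite normB; apply: update_ball => // l.
by rewrite normB; apply: update_ball.
Qed.

(** An active interaction lowers the sum by exactly [2 * m * (1 - m)] times the squared gap, which
    is at least [m] times it since [m <= 1 / 2]. *)
Lemma update_sum_sqr (m : R) p (x : V -> 'rV[R]_d) q : 0 <= m <= 1 / 2 ->
  \sum_k (update nrm eps m p x k 0 q) ^+ 2 <= \sum_k (x k 0 q) ^+ 2 /\
  forall i j, p = Some (i, j) -> opinion_graph nrm eps x i j ->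
    \sum_k (update nrm eps m p x k 0 q) ^+ 2 + m * (x i 0 q - x j 0 q) ^+ 2
      <= \sum_k (x k 0 q) ^+ 2.
Proof.
move=> /andP[m0 m1]; case: p => [[i j]|]; last by split.
pose S := \sum_(k | (k != i) && (k != j)) (x k 0 q) ^+ 2.
pose g := (opinion_graph nrm eps x i j)%:R : R.
have g01 : 0 <= m * g <= m.
  by rewrite /g; case: opinion_graph; rewrite ?mulr1 ?mulr0 ?lexx ?m0.
set y := update _ _ _ _ _.
have yE : \sum_k (y k 0 q) ^+ 2 =
    \sum_k (x k 0 q) ^+ 2 - 2 * (m * g) * (1 - m * g) * (x i 0 q - x j 0 q) ^+ 2.
  (* A selected pair with [i = j] is possible at this level; it moves nobody. *)
  have [eij|nij] := eqVneq i j.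
    rewrite -eij subrr expr0n mulr0 subr0; apply: eq_bigr => k _.
    rewrite /y /= eij; case: eqP => [->|//].
    by rewrite /moved subrr scaler0 addr0.
  have nji : j != i by rewrite eq_sym.
  have split_ij (f : V -> R) :
      \sum_k f k = f i + (f j + \sum_(k | (k != i) && (k != j)) f k).
    by rewrite (bigD1 i) //= (bigD1 j).
  have yS : \sum_(k | (k != i) && (k != j)) (y k 0 q) ^+ 2 = S.
    by apply: eq_bigr => k /andP[ki kj]; rewrite /y /= (negbTE ki) (negbTE kj).
  rewrite !split_ij yS -/S /y /= !eqxx (negbTE nji) /moved (opinion_graph_sym x j i) -/g.
  by rewrite !mxE; ring.
have d0 := sqr_ge0 (x i 0 q - x j 0 q).
rewrite yE; split; first by rewrite gerBl mulr_ge0 // mulr_ge0 //; lra.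
move=> a b [<- <-] gij; rewrite /g gij mulr1.
have : m * (1 - 2 * m) * (x i 0 q - x j 0 q) ^+ 2 >= 0.
  by rewrite mulr_ge0 // mulr_ge0 //; lra.
by lra.
Qed.

End Averaging.

(** * The dynamics along one sample path *)

Section Dynamics.
Context (R : realType) (d : nat) (nrm : 'rV[R]_d -> R) (V : finType) (eps : R).
Context (mu : nat -> R) (x0 : V -> 'rV[R]_d) (s : nat -> option (V * V)).
Context (nrm_norm : is_norm nrm) (mu_range : forall t, 0 <= mu t <= 1 / 2).

Let x := opinion nrm eps mu x0 s.

Lemma opinion_diameter t0 D :
  (forall i j, nrm (x t0 i - x t0 j) <= D) ->
  forall t, (t0 <= t)%N -> forall i j, nrm (x t i - x t j) <= D.
Proof.
move=> xD; elim=> [|t IHt]; first by rewrite leqn0 => /eqP t00; rewrite t00 in xD.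
rewrite leq_eqVlt => /predU1P[<-//|/IHt {}IHt] i j /=.
by apply: update_diameter => //; have := mu_range t; lra.
Qed.

Lemma active_gap_eventually_le (mu0 : R) q h :
  0 < mu0 -> (forall t, mu0 <= mu t) -> 0 < h ->
  exists T, forall t, (T <= t)%N -> forall i j, s t = Some (i, j) ->
    opinion_graph nrm eps (x t) i j -> `|x t i 0 q - x t j 0 q| <= h.
Proof.
move=> mu0_gt0 mu0_le h0; pose Q t := \sum_k (x t k 0 q) ^+ 2.
have Qcvg : cvgn Q.
  apply: nonincreasing_is_cvgn.
    apply/nonincreasing_seqP => t.
    by have [] := update_sum_sqr eps nrm_norm (s t) (x t) q (mu_range t).
  by exists 0 => _ [t _ <-]; rewrite sumr_ge0 // => k _; exact: sqr_ge0.
(* Two values of [Q] within this distance of the limit differ by less than [mu0 * h ^+ 2]. *)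
have th0 : 0 < mu0 * h ^+ 2 / 2 by rewrite divr_gt0 // mulr_gt0 // exprn_gt0.
move/cvgrPdist_lt : Qcvg => /(_ _ th0)[T _ QT]; exists T => t Tt i j st gij.
have [_ /(_ i j st gij) drop] :=
  update_sum_sqr eps nrm_norm (s t) (x t) q (mu_range t).
have := QT t Tt; have := QT t.+1 (leqW Tt).
rewrite /= !ltr_norml => /andP[Q1 Q2] /andP[Q3 Q4].
have Qt1 : Q t.+1 = \sum_k (update nrm eps (mu t) (s t) (x t) k 0 q) ^+ 2 by [].
have Qt : Q t = \sum_k (x t k 0 q) ^+ 2 by [].
have gap2 : mu0 * (x t i 0 q - x t j 0 q) ^+ 2 < mu0 * h ^+ 2.
  apply: le_lt_trans (_ : mu t * (x t i 0 q - x t j 0 q) ^+ 2 < _).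
    by rewrite ler_wpM2r ?sqr_ge0.
  by lra.
rewrite ltr_pM2l // in gap2.
rewrite -(@ler_pXn2r _ 2) ?nnegrE ?normr_ge0 ?(ltW h0) //.
by rewrite real_normK ?num_real // ltW.
Qed.

(** An active pair has gap at most [h], so both agents lie on the same side of the cut, and
    averaging keeps them there. *)
Lemma cut_persists q T (c h : R) :
  (forall t, (T <= t)%N -> forall i j, s t = Some (i, j) ->
    opinion_graph nrm eps (x t) i j -> `|x t i 0 q - x t j 0 q| <= h) ->
  (forall j, c < x T j 0 q -> c + h < x T j 0 q) ->
  forall t, (T <= t)%N -> forall k,
    if x T k 0 q <= c then x t k 0 q <= c else c + h < x t k 0 q.
Proof.
move=> gap_le cut; elim=> [|t IHt].
  by rewrite leqn0 => /eqP T0 k; rewrite T0 in cut *; case: (leP _ c) => // xk; exact: cut.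
rewrite leq_eqVlt => /predU1P[<- k|]; first by case: (leP _ c) => // xk; exact: cut.
rewrite ltnS => Tt k; rewrite -[x t.+1]/(update nrm eps (mu t) (s t) (x t)); have {}IHt := IHt Tt.
case: (update_cases nrm eps (mu t) (s t) (x t) k) => [->|[l [st gkl ->]]].
  exact: IHt.
have : `|x t k 0 q - x t l 0 q| <= h.
  case: st => st; first exact: gap_le.
  by rewrite distrC; apply: gap_le => //; rewrite opinion_graph_sym.
clear st gkl; rewrite ler_norml !mxE => /andP[g1 g2].
have /andP[m0 m1] := mu_range t.
have := IHt k; have := IHt l.
have -> : x t k 0 q + mu t * (x t l 0 q - x t k 0 q) =
  (1 - mu t) * x t k 0 q + mu t * x t l 0 q by ring.
case: (leP _ c) => _ xl; case: (leP _ c) => _ xk.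
- by nra.
- by exfalso; lra.
- by exfalso; lra.
- by nra.
Qed.

Context (mu0 : R) (mu0_gt0 : 0 < mu0) (mu0_le : forall t, mu0 <= mu t).
Context (e : rel V) (e_connected : graph_connected e).
Context (e_selected : forall a b, e a b ->
  forall m, exists2 t, (m <= t)%N & s t = Some (a, b)).
Context (t0 : nat) (x_close : forall i j, nrm (x t0 i - x t0 j) <= eps).

(* A cut wider than every later active interaction is never crossed again,
   although some pair of [e] across it is selected later. *)
Lemma coordinate_eventually_close q h : 0 < h ->
  exists T, forall t, (T <= t)%N -> forall i j, `|x t i 0 q - x t j 0 q| <= h.
Proof.
(* [gap_or_close] costs a factor [#|V|]; the successor keeps [h'] positive even for empty [V]. *)
move=> h0; pose h' := h / #|V|.+1%:R.
have h'0 : 0 < h' by rewrite divr_gt0.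
have [T gap_le] := active_gap_eventually_le q mu0_gt0 mu0_le h'0.
(* From [T] on active gaps are at most [h']; from [t0] on every selection is active. *)
exists (maxn T t0) => t; rewrite geq_max => /andP[Tt t0t] i j.
have [close|[c [[a ac] [b bc] cut]]] := gap_or_close (fun k => x t k 0 q) (ltW h'0).
  apply: le_trans (close i j) _; rewrite /h' mulrA ler_pdivrMr // mulrC.
  by rewrite ler_wpM2l ?(ltW h0) // ler_nat.
exfalso; have [a' [b' [eab a'c b'c]]] :
    exists a b, [/\ e a b, x t a 0 q <= c & ~~ (x t b 0 q <= c)].
  apply: (connect_crossing (A := fun k => x t k 0 q <= c) (e_connected a b)) => //.
  by rewrite -ltNge.
have [t' tt' st'] := e_selected eab t.
have gap_le' u : (t <= u)%N -> forall i j, s u = Some (i, j) ->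
    opinion_graph nrm eps (x u) i j -> `|x u i 0 q - x u j 0 q| <= h'.
  by move=> tu; apply: gap_le; exact: leq_trans Tt tu.
have persist := cut_persists gap_le' cut tt'.
have := persist a'; have := persist b'; rewrite a'c (negbTE b'c) => hb ha.
have : `|x t' a' 0 q - x t' b' 0 q| <= h'.
  apply: gap_le st' _; first exact: leq_trans Tt tt'.
  by apply: (opinion_diameter x_close); exact: leq_trans t0t tt'.
by rewrite ler_norml => /andP[]; lra.
Qed.

Lemma close_consensus : consensus nrm x.
Proof.
have [M M0 nrmM] := norm_le_coordinates nrm_norm.
suff cvg0 : (fun t => \big[Num.max/0]_i \big[Num.max/0]_j nrm (x t i - x t j))
    @ \oo --> (0 : R).
  apply: (cvg_limn_einf_sup _).2; apply: cvg_EFin => //; exact: nearW.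
apply/cvgrPdist_le => h h0.
have hM : 0 < h / M by rewrite divr_gt0.
have /choice[T xT] := fun q => coordinate_eventually_close q hM.
(* There are finitely many coordinates, hence one time that suits all. *)
exists (\max_q T q)%N => // t /= Tt.
rewrite sub0r normrN ger0_norm; last by apply: bigmax_ge_id.
apply: bigmax_le => [|i _]; first exact: ltW.
apply: bigmax_le => [|j _]; first exact: ltW.
have -> : h = M * (h / M) by rewrite mulrC divfK // gt_eqF.
apply: nrmM => [|q]; first exact: ltW.
rewrite !mxE; apply: xT; apply: leq_trans Tt; exact: leq_bigmax.
Qed.

End Dynamics.

(** * Recurrence of selections by independence *)

Section Selection.
Context (R : realType) (disp : measure_display) (Omega : measurableType disp).
Context (P : probability Omega R).

(** The intersection of the covers [B n] is measurable, contains [A] and has probability below every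
    power of [p]; [A] itself may be nonmeasurable. *)
Lemma negligible_le_powers (p : R) (A : set Omega) :
  0 <= p < 1 ->
  (forall n, exists B, [/\ A `<=` B, measurable B & (P B <= (p ^+ n)%:E)%E]) ->
  P.-negligible A.
Proof.
move=> /andP[p0 p1] /choice[B AB]; exists (\bigcap_n B n); split.
- by apply: bigcapT_measurable => n; have [] := AB n.
- have mB : measurable (\bigcap_n B n).
    by apply: bigcapT_measurable => n; have [] := AB n.
  have PBle n : (P (\bigcap_n B n) <= (p ^+ n)%:E)%E.
    have [_ mBn] := AB n; apply: le_trans; apply: le_measure; rewrite ?inE //.
    exact: bigcap_inf.
  have fP := fin_num_measure P _ mB.
  rewrite -(fineK fP) in PBle *; congr (_%:E); apply/eqP.
  rewrite eq_le fine_ge0 ?measure_ge0 // andbT leNgt; apply/negP => r0.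
  have : `|p| < 1 by rewrite ger0_norm.
  move=> /cvg_expr/cvgrPdist_lt/(_ _ r0)[N _ /(_ N (leqnn N))] /=.
  rewrite sub0r normrN ger0_norm ?exprn_ge0 // ltNge.
  by have := PBle N; rewrite lee_fin => ->.
- by move=> w Aw n _; have [+ _ _] := AB n; exact.
Qed.

(** By independence, missing [q] at [n] or more times of [S] after [m] has probability at most
    [(1 - p) ^+ n]. *)
Lemma selected_infinitely_often (d : nat) (V : finType)
    (X0 : V -> Omega -> 'rV[R]_d) (sel : nat -> Omega -> option (V * V))
    (q : option (V * V)) (S : set nat) (p : R) :
  mutually_independent P (source_events X0 sel) -> infinite_set S -> 0 < p ->
  (forall t, S t -> measurable (sel t @^-1` [set q]) /\
                    P (sel t @^-1` [set q]) = p%:E) ->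
  {ae P, forall w m, exists2 t, (m <= t)%N & sel t w = q}.
Proof.
move=> indep Sinf p0 Sp; apply: ae_foralln => m.
have Sm : infinite_set (S `\` [set t | (t < m)%N]).
  exact/infinite_setD/finite_II.
have p1 : p <= 1.
  have [t /Sp[mt Pt]] := infinite_setN0 Sinf.
  by rewrite -lee_fin -Pt probability_le1.
apply: (@negligible_le_powers (1 - p)) => [|n]; first by lra.
have [J JS nJ] := infinite_set_fset n Sm.
have Jsel t : t \in J -> [/\ (m <= t)%N, measurable (sel t @^-1` [set q]) &
    P (sel t @^-1` [set q]) = p%:E].
  by move=> /JS[St /negP]; rewrite -leqNgt => mt; have [] := Sp t St.
pose K : {fset V + nat} := [fset inr t | t in J]%fset.
(* [setT] is a filler: [K] contains only selection indices. *)
pose B (k : V + nat) : set Omega :=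
  if k is inr t then ~` (sel t @^-1` [set q]) else setT.
have BP t : t \in J -> measurable (B (inr t)) /\ P (B (inr t)) = (1 - p)%:E.
  move=> /Jsel[_ mt Pt]; split; first exact: measurableC.
  by rewrite probability_setC // Pt.
exists (\bigcap_(k in [set` K]) B k); split.
- move=> w nsel _ /= /imfsetP[t tJ ->] /= selt.
  by apply: nsel; exists t => //; have [] := Jsel t tJ.
- apply: fin_bigcap_measurable => // _ /= /imfsetP[t tJ ->].
  by have [] := BP t tJ.
- rewrite indep; last first.
    by move=> _ /imfsetP[t _ ->]; exists (~` [set q]).
  rewrite big_imfset => [|? ? _ _ []//] /=.
  rewrite (eq_big_seq (fun=> (1 - p)%:E)); last by move=> t /BP[].
  rewrite prodEFin big_const_seq count_predT iter_mulr mulr1 lee_fin.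
  by apply: ler_wiXn2l nJ; lra.
Qed.
End Selection.

(** * A recurrent edge set, settled profiles and the conclusion *)

Lemma recurrent_connected_edges (V : finType) (G : nat -> rel V) :
  infinite_set [set t | graph_connected (G t)] ->
  exists E : {set V * V},
    infinite_set [set t | graph_connected (G t) /\ edges (G t) = E].
Proof.
move=> Ginf; apply: contrapT => /forallNP Efin; apply: Ginf.
(* Pigeonhole: a finite [V] carries finitely many edge sets. *)
apply: (@sub_finite_set _ _
    (\bigcup_(E in [set: {set V * V}]) [set t | graph_connected (G t) /\ edges (G t) = E])).
  by move=> t Gt; exists (edges (G t)).
by apply: bigcup_finite => // E _; apply: contrapT; exact: Efin.
Qed.

(** An infimum over no times is +oo, so a finite settling time yields some [t] whose profile is
    connected by edges of length at most [delta]. *)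
Lemma settled_close (R : realType) (d : nat) (nrm : 'rV[R]_d -> R) (V : finType)
    (eps : R) (G : nat -> rel V) (c : 'rV[R]_d) (rho delta : R)
    (x : nat -> V -> 'rV[R]_d) :
  is_norm nrm -> 0 <= delta -> near_center nrm eps G c rho delta x ->
  exists t, forall i j, nrm (x t i - x t j) <= #|V|%:R * delta.
Proof.
move=> nrm_norm delta0 [T TE _].
have [t [Gt edge_le]] : settling_times nrm eps G delta x !=set0.
  apply/set0P/eqP => S0; move: TE; rewrite /settling_time S0 image_set0.
  by rewrite ereal_inf0.
exists t => i j; apply: (connect_dist_le (D := fun i j => nrm (x t i - x t j)) delta0 _ _ _ (Gt i j)).
- by move=> k; rewrite subrr norm0.
- by move=> a b k; exact: norm_dist_triangle.
- by move=> a b; exact: edge_le.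
Qed.

Theorem lemma4 (R : realType) (d : nat) (nrm : 'rV[R]_d -> R) (V : finType)
    (eps : R) (mu : nat -> R) (G : nat -> rel V)
    (Delta : set 'rV[R]_d) (c : 'rV[R]_d)
    (disp : measure_display) (Omega : measurableType disp)
    (P : probability Omega R)
    (X0 : V -> Omega -> 'rV[R]_d) (sel : nat -> Omega -> option (V * V))
    (nrm_norm : is_norm nrm)
    (eps_gt0 : 0 < eps)
    (mu_range : forall t, 0 <= mu t <= 1 / 2)
    (G_simple : forall t, simple_graph (G t))
    (G_connected : infinite_set [set t | graph_connected (G t)])
    (Delta_bounded : norm_bounded nrm Delta)
    (Delta_convex : convex_set Delta)
    (c_center : is_center nrm Delta c)
    (X0_random : forall i, random_vector (X0 i))
    (X0_Delta : forall i w, Delta (X0 i w))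
    (X0_ident : identically_distributed P X0)
    (sel_uniform : uniform_selection P G sel)
    (sources_indep : mutually_independent P (source_events X0 sel))
    (mu_inf : 0 < inf (range mu))
    (eps_radius : radius_from nrm Delta c < eps) :
  let x (w : Omega) := opinion nrm eps mu (X0 ^~ w) (sel ^~ w) in
  exists2 delta : R, 0 < delta &
    forall eta : R, 0 < eta < eps - radius_from nrm Delta c ->
      let A := [set w | near_center nrm eps G c
                          (eps - radius_from nrm Delta c - eta) delta (x w)] in
      let C := [set w | consensus nrm (x w)] in
      {ae P, forall w, A w -> C w}.
Proof.
move=> x; pose delta := eps / #|V|.+1%:R.
have delta0 : 0 < delta by rewrite divr_gt0.
exists delta => // eta _.
have mu0_le t : inf (range mu) <= mu t.
  apply: ge_inf; last by exists t.
  by exists 0 => _ [s _ <-]; have /andP[] := mu_range s.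
have [E Einf] := recurrent_connected_edges G_connected.
have E_selected : {ae P, forall w (q : V * V), q \in E ->
    forall m, exists2 t, (m <= t)%N & sel t w = Some q}.
  (* Finitely many pairs [q], so the almost sure events can be treated one at a time. *)
  apply: filter_forall => q; have [qE|_] := boolP (q \in E); last exact: nearW.
  have E0 : (0 < #|E|)%N by apply/card_gt0P; exists q.
  (* The law of the selection is the same, uniform on [E], at all the recurrent times. *)
  have Eq t : [set t | graph_connected (G t) /\ edges (G t) = E] t ->
      measurable (sel t @^-1` [set Some q]) /\
      P (sel t @^-1` [set Some q]) = (#|E|%:R^-1)%:E.
    by case=> _ EE; have := sel_uniform t (Some q); rewrite EE qE.
  apply: filterS (selected_infinitely_often sources_indep Einf _ Eq).
    by move=> w ?.
  by rewrite invr_gt0 ltr0n.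
apply: filterS E_selected => w wE /(settled_close nrm_norm (ltW delta0))[t0 xt0].
apply: (close_consensus nrm_norm mu_range mu_inf mu0_le (e := fun i j => (i, j) \in E) _ _ (t0 := t0)).
(* [E] is the edge set of some connected [G t], hence connected. *)
- move=> i j; have [t [Gt EE]] := infinite_setN0 Einf.
  rewrite (@eq_connect _ _ (G t)); first exact: Gt.
  by move=> a b; rewrite -EE inE.
- by move=> a b; exact: wE.
- move=> i j; apply: le_trans (xt0 i j) _.
  rewrite /delta mulrA ler_pdivrMr // mulrC ler_wpM2l ?(ltW eps_gt0) //.
  by rewrite ler_nat.
Qed.
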